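(* Let $n\ge 1$. There is a constant $C>0$ depending only on $n$ such that the following holds. Let $\Omega\subset\mathbb{R}^n$ be a bounded open domain, let $\delta>0$ and $0<h<\delta/2$, let $\Omega_{\mathcal I}=\{y\in\mathbb{R}^n\setminus\Omega:\ \exists\,x\in\Omega \text{ with } |x-y|\le\delta\}$ and $\hat\Omega=\Omega\cup\Omega_{\mathcal I}$. For each $x\in\Omega$ let $B_{\delta,h}(x)$ be an inscribed polyhedral approximation of the Euclidean ball $B_\delta(x)$. Assume that, for every $x\in\Omega$, the maximum edge length of $B_{\delta,h}(x)$ is less than $h$ and every face of $B_{\delta,h}(x)$ is an $(n-1)$-dimensional simplex. Then $$\sup_{x\in\Omega}\bigl|\hat\Omega\cap\Delta B_{\delta,h}(x)\bigr|+\sup_{x\in\hat\Omega}\bigl|\Omega\cap\Delta B'_{\delta,h}(x)\bigr|\ \le\ C\,h^2\,\delta^{n-2}.$$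
   Context: $|\cdot|$ of a vector is the Euclidean norm, and $|\cdot|$ of a set is its $n$-dimensional Lebesgue measure (all sets whose measure is taken are tacitly assumed measurable). $B_r(x)=\{y\in\mathbb{R}^n: |y-x|<r\}$ is the Euclidean ball of radius $r$ centered at $x$. An inscribed polyhedral approximation of $B_\delta(x)$ is a bounded $n$-dimensional polyhedral region (a finite union of $n$-dimensional simplices, not necessarily convex) which contains the center $x$ and all of whose boundary vertices lie on the sphere $\partial B_\delta(x)$. ''Faces'' are the $(n-1)$-dimensional faces making up the boundary of the region; the condition that every face is an $(n-1)$-simplex means that the boundary is a finite union of $(n-1)$-dimensional simplices whose vertices are the boundary vertices of the region. Its edges are the edges of these simplices. Notation: - $\Delta B_{\delta,h}(x)=(B_\delta(x)\setminus B_{\delta,h}(x))\cup(B_{\delta,h}(x)\setminus B_\delta(x))$ for $x\in\Omega$; - $B'_{\delta,h}(x)=\{y\in\Omega:\ x\in B_{\delta,h}(y)\}$ for $x\in\hat\Omega$; - $\Delta B'_{\delta,h}(x)=(B_\delta(x)\setminus B'_{\delta,h}(x))\cup(B'_{\delta,h}(x)\setminus B_\delta(x))$ for $x\in\hat\Omega$. *)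

(* Defs.v *)
From HB Require Import structures.
From mathcomp Require Import all_boot all_order all_algebra.
From mathcomp Require Import all_classical all_reals all_analysis.

Set Implicit Arguments.
Unset Strict Implicit.
Unset Printing Implicit Defensive.

Import Order.TTheory GRing.Theory Num.Theory.
Import numFieldNormedType.Exports.

Local Open Scope classical_set_scope.
Local Open Scope ring_scope.

(* Points of R^n are row vectors. The canonical norm of MathComp-Analysis on
   'rV[R]_n is the sup norm; it induces the usual topology and the usual bounded
   sets, but distances have to be measured with [enorm]. *)

Section Euclidean.
Context {R : realType} {n : nat}.
Implicit Types (x y d : 'rV[R]_n) (r : R) (A P : set 'rV[R]_n).

Definition enorm x : R := Num.sqrt (\sum_(i < n) x ord0 i ^+ 2).

Definition eball x r : set 'rV[R]_n := [set y | enorm (y - x) < r].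

Definition esphere x r : set 'rV[R]_n := [set y | enorm (y - x) = r].

Definition box (a b : 'rV[R]_n) : set 'rV[R]_n :=
  [set y | forall i, a ord0 i <= y ord0 i <= b ord0 i].

Definition box_volume (a b : 'rV[R]_n) : R :=
  \prod_(i < n) (b ord0 i - a ord0 i).

(* n-dimensional Lebesgue measure, as the infimum of the total volume of
   countable covers by boxes. It is the Lebesgue measure on the sets that are
   Caratheodory measurable for it, see [lebesgue_measurable]. *)
Definition lebesgue_measure_n A : \bar R :=
  ereal_inf [set s | exists a b : nat -> 'rV[R]_n,
    [/\ forall k i, a k ord0 i <= b k ord0 i,
        A `<=` \bigcup_k box (a k) (b k) &
        s = (\sum_(0 <= k <oo) (box_volume (a k) (b k))%:E)%E]].

Definition lebesgue_measurable A : Prop :=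
  lebesgue_measure_n.-caratheodory A.

(* A k-dimensional simplex is given by the matrix whose k+1 rows are its
   vertices. *)
Definition affinely_independent k (v : 'M[R]_(k.+1, n)) : Prop :=
  forall c : 'rV[R]_k.+1,
    \sum_i c ord0 i = 0 -> c *m v = 0 -> c = 0.

Definition simplex k (v : 'M[R]_(k.+1, n)) : set 'rV[R]_n :=
  [set c *m v | c in [set c : 'rV[R]_k.+1 |
    (forall i, 0 <= c ord0 i) /\ \sum_i c ord0 i = 1]].

Definition vertices k (v : 'M[R]_(k.+1, n)) : set 'rV[R]_n :=
  [set row i v | i in [set: 'I_k.+1]].

Definition simplicial_decomposition k (S : set 'M[R]_(k.+1, n)) P : Prop :=
  [/\ finite_set S,
      forall v, S v -> affinely_independent v &
      P = \bigcup_(v in S) simplex v].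

Definition polyhedral_region P : Prop :=
  exists S : set 'M[R]_(n.+1, n), simplicial_decomposition S P.

Definition boundary A : set 'rV[R]_n := closure A `\` A°.

(* Near any of its points v, a polyhedral region coincides with a cone with apex
   v. A boundary point is a vertex when this cone is not invariant under
   translation along any line; otherwise the point lies in the relative interior
   of a boundary face of positive dimension. Convexity of the region is not assumed, so
   vertices need not be extreme points. *)
Definition locally_invariant P v d : Prop :=
  exists2 e : R, 0 < e &
    forall y (t : R), eball v e y -> eball v e (y + t *: d) ->
      (P y <-> P (y + t *: d)).

Definition boundary_vertices P : set 'rV[R]_n :=
  [set v | boundary P v /\ forall d, d != 0 -> ~ locally_invariant P v d].

Definition inscribed_polyhedral_approx x r P : Prop :=
  [/\ polyhedral_region P, P x & boundary_vertices P `<=` esphere x r].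

(* [F] is the family of the faces of [P], all of them being (n-1)-simplices. For
   n > 0, n.-1.+1 is n, the number of vertices of an (n-1)-simplex. *)
Definition simplicial_faces P (F : set 'M[R]_(n.-1.+1, n)) : Prop :=
  simplicial_decomposition F (boundary P) /\
  \bigcup_(v in F) vertices v = boundary_vertices P.

Definition edges_shorter_than k (F : set 'M[R]_(k.+1, n)) (h : R) : Prop :=
  forall v, F v -> forall i j, i != j -> enorm (row i v - row j v) < h.

Definition interaction_domain A r : set 'rV[R]_n :=
  [set y | ~ A y /\ exists2 x, A x & enorm (x - y) <= r].

Definition dual_ball A (B : 'rV[R]_n -> set 'rV[R]_n) x : set 'rV[R]_n :=
  [set y | A y /\ B y x].

End Euclidean.

(* Main.v *)
Require Import Defs.
From HB Require Import structures.
From mathcomp Require Import all_boot all_order all_algebra.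
From mathcomp Require Import all_classical all_reals all_analysis.
From mathcomp Require Import zify ring lra.

Set Implicit Arguments.
Unset Strict Implicit.
Unset Printing Implicit Defensive.

Import Order.TTheory GRing.Theory Num.Theory.
Import numFieldNormedType.Exports.

Local Open Scope classical_set_scope.
Local Open Scope ring_scope.

(** Everything happens in the thin spherical shell
    delta^2 - h^2 <= |y - x|^2 <= delta^2.

    A boundary point p of a polyhedral approximation is a convex combination,
    with weights c_i, of points v_i of the sphere at mutual distance less than
    h, and the variance identity
      2 (delta^2 - |p - x|^2) = sum_(i, j) c_i c_j |v_i - v_j|^2
    puts it in the shell ([simplex_in_shell]). A segment that joins a point of
    the polyhedron to a point outside it crosses the boundary
    ([segment_meets_boundary]), hence the shell. Applied to the segment from
    the center to a point missing from the polyhedron, and to a ray leaving the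
    bounded polyhedron from a point outside the ball, this shows that the ball
    and the polyhedron differ only inside the shell
    ([ball_symdiff_sub_shell]). The shell relation is symmetric in x and y, so
    the dual balls obey the same inclusion with the roles of x and y exchanged.

    It remains to bound the outer measure of the shell by a multiple of
    h^2 delta^(n-2) ([lebesgue_measure_n_shell_le]). The shell is cut into
    pieces according to which coordinate of y - x is the largest, to the sign
    of that coordinate, and to the cell of a grid of mesh eta = h^2 / delta that
    contains the n - 1 other coordinates. In one piece the square of the
    largest coordinate varies by O(h^2), while the coordinate itself is at
    least of order delta, so it varies by O(h^2 / delta) = O(eta). Each piece
    thus fits in a box of volume O(eta^n), and there are O((delta / eta)^(n-1))
    pieces. *)

(** * The Euclidean norm *)

Lemma sqr_enorm (R : realType) n (x : 'rV[R]_n) :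
  enorm x ^+ 2 = \sum_i x ord0 i ^+ 2.
Proof. by rewrite sqr_sqrtr// sumr_ge0// => i _; rewrite sqr_ge0. Qed.

Lemma enorm_ge0 (R : realType) n (x : 'rV[R]_n) : 0 <= enorm x.
Proof. exact: sqrtr_ge0. Qed.

Lemma enorm_distC (R : realType) n (x y : 'rV[R]_n) :
  enorm (x - y) = enorm (y - x).
Proof.
by rewrite /enorm; congr Num.sqrt; apply: eq_bigr => i _; rewrite !mxE -sqrrN opprB.
Qed.

Lemma sqr_enormZ (R : realType) n (t : R) (x : 'rV[R]_n) :
  enorm (t *: x) ^+ 2 = t ^+ 2 * enorm x ^+ 2.
Proof.
by rewrite !sqr_enorm mulr_sumr; apply: eq_bigr => i _; rewrite mxE exprMn.
Qed.

(** * Boundary crossings *)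

(** If the segment avoided the boundary, its trace on P would be both open
    (equal to the trace of the interior) and closed (equal to the trace of the
    closure) in the segment, which is connected. *)
Lemma segment_meets_boundary (R : realType) n (P : set 'rV[R]_n) p q :
  P p -> ~ P q ->
  exists2 t : R, 0 <= t <= 1 & boundary P (p + t *: (q - p)).
Proof.
move=> Pp Pq; apply: contrapT => noB.
pose g (t : R) := p + t *: (q - p).
have gc : continuous g.
  by move=> t; apply: cvgD; [exact: cvg_cst|apply: cvgZl; exact: cvg_id].
have clint t : 0 <= t <= 1 -> closure P (g t) -> P° (g t).
  by move=> t01 clt; apply: contrapT => nint; apply: noB; exists t.
have E : `[0, 1] `&` g @^-1` P° = `[0, 1]%classic :> set R.
  apply: segment_connected.
  - exists 0; split; first by rewrite /= in_itv/= lexx ler01.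
    apply: clint; first by rewrite lexx ler01.
    by apply: subset_closure; rewrite /g scale0r addr0.
  - exists (g @^-1` P°) => //.
    by move/continuousP : gc; apply; exact: open_interior.
  - exists (g @^-1` closure P).
      by move/continuous_closedP : gc; apply; exact: closed_closure.
    apply/seteqP; split => t /= [t01 gt]; split=> //.
      exact: subset_closure (interior_subset gt).
    by apply: (clint t) => //; move: t01; rewrite in_itv.
have : (`[0, 1]%classic : set R) 1 by rewrite /= in_itv/= lexx ler01.
rewrite -E => -[_ /interior_subset].
by rewrite /g scale1r addrC subrK.
Qed.

(** * Simplices inscribed in a sphere *)

(** The variance of a random variable is half the mean square difference of two
    independent copies of it; c is the distribution and a the variable. *)
Lemma weighted_variance (R : comRingType) k (c a : 'I_k -> R) :
  \sum_i c i = 1 ->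
  \sum_i \sum_j c i * c j * (a i - a j) ^+ 2 =
  (\sum_i c i * a i ^+ 2 - (\sum_i c i * a i) ^+ 2) *+ 2.
Proof.
move=> c1; set S := \sum_i c i * a i; set Q := \sum_i c i * a i ^+ 2.
transitivity (\sum_i (c i * a i ^+ 2 - c i * a i * (S *+ 2) + c i * Q)).
  apply: eq_bigr => i _.
  transitivity (\sum_j (c i * a i ^+ 2 * c j
      - c i * a i *+ 2 * (c j * a j) + c i * (c j * a j ^+ 2))).
    by apply: eq_bigr => j _; ring.
  rewrite big_split sumrB /= -!mulr_sumr c1 -/S -/Q; ring.
rewrite big_split sumrB /= -!mulr_suml c1 -/S -/Q; ring.
Qed.

Definition shell (R : realType) n (x : 'rV[R]_n) (r h : R) : set 'rV[R]_n :=
  [set y | r ^+ 2 - h ^+ 2 <= enorm (y - x) ^+ 2 <= r ^+ 2].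

Lemma shell_sym (R : realType) n (x y : 'rV[R]_n) (r h : R) :
  shell x r h y -> shell y r h x.
Proof. by rewrite /shell/= enorm_distC. Qed.

(** Summed over the coordinates, the variance identity says that
    2 (r^2 - |p - x|^2) is a weighted mean of the squared distances between the
    vertices, which lie between 0 and h^2. *)
Lemma simplex_in_shell (R : realType) k n (v : 'M[R]_(k.+1, n)) x r h :
  0 <= h -> vertices v `<=` esphere x r ->
  (forall i j, i != j -> enorm (row i v - row j v) <= h) ->
  simplex v `<=` shell x r h.
Proof.
move=> h0 vr vh _ [c [c0 c1] <-]; rewrite /shell/=.
have vr2 i : enorm (row i v - x) ^+ 2 = r ^+ 2.
  by rewrite (vr (row i v))//; exists i.
have dot l : (c *m v - x) ord0 l = \sum_i c ord0 i * (row i v - x) ord0 l.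
  rewrite !mxE -[x ord0 l]mul1r -c1 mulr_suml -sumrB.
  by apply: eq_bigr => i _; rewrite !mxE mulrBr.
have var : \sum_i \sum_j c ord0 i * c ord0 j * enorm (row i v - row j v) ^+ 2
           = (r ^+ 2 - enorm (c *m v - x) ^+ 2) *+ 2.
  transitivity (\sum_l \sum_i \sum_j c ord0 i * c ord0 j *
      ((row i v - x) ord0 l - (row j v - x) ord0 l) ^+ 2).
    rewrite [RHS]exchange_big; apply: eq_bigr => i _.
    rewrite [RHS]exchange_big; apply: eq_bigr => j _.
    rewrite sqr_enorm mulr_sumr; apply: eq_bigr => l _.
    by rewrite !mxE; congr (_ * _ ^+ 2); ring.
  under eq_bigr do rewrite weighted_variance//.
  rewrite sumrMnl sumrB; congr ((_ - _) *+ 2).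
    rewrite exchange_big -[RHS]mul1r -c1 mulr_suml; apply: eq_bigr => i _.
    by rewrite -mulr_sumr -sqr_enorm vr2.
  by rewrite sqr_enorm; apply: eq_bigr => l _; rewrite dot.
have var_ge0 : 0 <= (r ^+ 2 - enorm (c *m v - x) ^+ 2) *+ 2.
  rewrite -var sumr_ge0// => i _; rewrite sumr_ge0// => j _.
  by rewrite mulr_ge0 ?sqr_ge0// mulr_ge0.
have var_le : (r ^+ 2 - enorm (c *m v - x) ^+ 2) *+ 2 <= h ^+ 2.
  rewrite -var -[leRHS]mul1r -c1 mulr_suml ler_sum// => i _.
  rewrite -[leRHS]mulr1 -c1 mulr_sumr ler_sum// => j _.
  rewrite mulrAC ler_wpM2r// ler_wpM2l//.
  have [->|/vh vij] := eqVneq i j; last by rewrite lerXn2r// nnegrE enorm_ge0.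
  by rewrite subrr sqr_enorm big1 ?sqr_ge0// => l _; rewrite mxE expr0n.
have := sqr_ge0 h; lra.
Qed.

Lemma polyhedral_region_bounded (R : realType) n (P : set 'rV[R]_n) :
  polyhedral_region P ->
  exists M : R, forall p, P p -> forall i, `|p ord0 i| <= M.
Proof.
move=> [S [/finite_seqP[s ->] _ ->]].
exists (\sum_(v <- s) \sum_i \sum_j `|v i j|) => p [v /= vs [c [c0 c1] <-]] j.
rewrite (big_rem v)//= -[leLHS]addr0 lerD//; last first.
  by rewrite sumr_ge0// => w _; rewrite sumr_ge0// => i _; rewrite sumr_ge0.
rewrite mxE; apply: le_trans (ler_norm_sum _ _ _) _.
apply: ler_sum => i _; rewrite normrM (bigD1 j)//= -[leLHS]addr0 lerD ?sumr_ge0//.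
rewrite -[leRHS]mul1r ler_wpM2r// ger0_norm// -c1 (bigD1 i)//=.
by rewrite lerDl sumr_ge0.
Qed.

Lemma ray_leaves_bounded (R : realType) n (P : set 'rV[R]_n) (M : R) x y :
  (forall p, P p -> forall i, `|p ord0 i| <= M) -> y != x ->
  exists2 t : R, 1 <= t & ~ P (x + t *: (y - x)).
Proof.
move=> PM; rewrite -subr_eq0 => yx.
have [i di0] : exists i, (y - x) ord0 i != 0.
  apply: contrapT => nz; move/eqP: yx; apply; apply/rowP => i; rewrite [RHS]mxE.
  by apply/eqP; apply: contrapT => /negP ?; apply: nz; exists i.
set d := (y - x) ord0 i in di0.
exists (1 + (`|M| + `|x ord0 i|) / `|d|).
  by rewrite lerDl divr_ge0// addr_ge0.
set t := 1 + _ => /PM /(_ i); rewrite !mxE.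
have -> : y ord0 i - x ord0 i = d by rewrite /d !mxE.
have d_gt0 : 0 < `|d| by rewrite normr_gt0.
have t0 : 0 <= t by rewrite /t addr_ge0// divr_ge0// addr_ge0.
have : `|t * d| = `|d| + `|M| + `|x ord0 i|.
  by rewrite normrM (ger0_norm t0) /t mulrDl mul1r divfK ?gt_eqF// addrA.
have := ler_norm M.
have : `|t * d| <= `|x ord0 i + t * d| + `|x ord0 i|.
  rewrite -[X in `|X| <= _](addrK (x ord0 i)) [X in `|X - _| <= _]addrC.
  exact: ler_normB.
lra.
Qed.

(** * The symmetric difference lies in the shell *)

(** Points of the ball missing from P are joined to the center, which is in P;
    points of P off the ball are followed outwards along the ray from the
    center. Either way the boundary point that is met bounds |y - x|. *)
Lemma ball_symdiff_sub_shell (R : realType) n (P : set 'rV[R]_n) x r h :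
  0 < r -> inscribed_polyhedral_approx x r P -> boundary P `<=` shell x r h ->
  eball x r `+` P `<=` shell x r h.
Proof.
move=> r0 [Ppoly Px _] Psh.
have on_ray y t : enorm (x + t *: (y - x) - x) ^+ 2 = t ^+ 2 * enorm (y - x) ^+ 2.
  by rewrite addrAC subrr add0r sqr_enormZ.
have ballE y : eball x r y <-> enorm (y - x) ^+ 2 < r ^+ 2.
  by rewrite /eball/= ltr_pXn2r// nnegrE ?enorm_ge0// ltW.
move=> y [[/ballE yr Py]|[Py /ballE/negP]]; last rewrite -leNgt => yr.
  apply/andP; split; last exact: ltW.
  have [t /andP[t0 t1] /Psh] := segment_meets_boundary Px Py.
  rewrite /shell/= on_ray => /andP[+ _]; move/le_trans; apply.
  by rewrite ler_piMl ?sqr_ge0// expr_le1.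
apply/andP; split; first by rewrite (le_trans _ yr)// gerBl sqr_ge0.
have [M PM] := polyhedral_region_bounded Ppoly.
have yx : y != x.
  apply/eqP => yx; move: yr; rewrite yx subrr -(scale0r x) sqr_enormZ expr0n/= mul0r.
  by rewrite leNgt exprn_gt0.
have [T T1 PT] := ray_leaves_bounded PM yx.
have [t /andP[t0 t1] /Psh] := segment_meets_boundary Py PT.
have -> : y + t *: (x + T *: (y - x) - y) = x + (1 + t * (T - 1)) *: (y - x).
  by apply/rowP => i; rewrite !mxE; ring.
rewrite /shell/= on_ray => /andP[_]; apply: le_trans.
by rewrite ler_peMl ?sqr_ge0// exprn_ege1// lerDl mulr_ge0// subr_ge0.
Qed.

(** * Outer measure of a set split into finitely many small pieces *)

(** Each class of f on A lies in the box centered at one of its points whose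
    half-sides are the widths w of the class. The finite family of boxes is
    completed to a sequence by the degenerate box at 0, of volume 0 since the
    dimension is positive. *)
Lemma lebesgue_measure_n_le_classes (R : realType) m (T : finType)
    (A : set 'rV[R]_m.+1) (f : 'rV[R]_m.+1 -> T) (w : T -> 'I_m.+1 -> R) (V : R) :
  (forall t j, 0 <= w t j) ->
  (forall y z, A y -> A z -> f y = f z ->
     forall j, `|y ord0 j - z ord0 j| <= w (f y) j) ->
  (forall t, \prod_j (w t j *+ 2) <= V) ->
  (lebesgue_measure_n A <= (#|T|%:R * V)%:E)%E.
Proof.
move=> w0 Aw wV.
pose c t := xget 0 [set y | A y /\ f y = t].
pose a k : 'rV[R]_m.+1 := if insub k is Some i then
  \row_j (c (enum_val i) ord0 j - w (@enum_val T predT i) j) else 0.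
pose b k : 'rV[R]_m.+1 := if insub k is Some i then
  \row_j (c (enum_val i) ord0 j + w (@enum_val T predT i) j) else 0.
have ab k i : a k ord0 i <= b k ord0 i.
  rewrite /a /b; case: insubP => // u _ _; rewrite !mxE lerD2l.
  by rewrite (le_trans _ (w0 _ _))// oppr_le0.
have vol0 k : (0 <= (box_volume (a k) (b k))%:E)%E.
  by rewrite lee_fin prodr_ge0// => i _; rewrite subr_ge0.
apply: (@le_trans _ _ (\sum_(0 <= k <oo) (box_volume (a k) (b k))%:E)%E).
  apply: ge_ereal_inf; exists (\sum_(0 <= k <oo) (box_volume (a k) (b k))%:E)%E => //.
  exists a, b; split=> // y Ay.
  exists (enum_rank (f y)) => // i.
  rewrite /a /b valK !mxE enum_rankK.
  have [|Ac fc] := @xgetPex _ 0 [set z | A z /\ f z = f y]; first by exists y.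
  by rewrite -ler_distl; exact: Aw.
rewrite (nneseries_split 0 #|T|)// add0n [X in (_ + X)%E]eseries0 ?adde0; last first.
  move=> k Tk _; rewrite /box_volume /a /b insubF ?ltnNge ?Tk//.
  by rewrite big_ord_recl mxE subrr mul0r.
rewrite big_mkord sumEFin lee_fin.
apply: (@le_trans _ _ (\sum_(k < #|T|) V)); last first.
  by rewrite sumr_const card_ord mulr_natl.
apply: ler_sum => k _; rewrite /box_volume /a /b valK.
apply: le_trans (wV (enum_val k)); rewrite le_eqVlt; apply/orP; left; apply/eqP.
by apply: eq_bigr => j _; rewrite !mxE; ring.
Qed.

(** * Covering the shell *)

Lemma same_cell_dist (R : realType) (eta u v : R) : 0 < eta -> 0 <= u -> 0 <= v ->
  Num.truncn (u / eta) = Num.truncn (v / eta) -> `|u - v| <= eta.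
Proof.
move=> e0 u0 v0 E.
have := truncn_itv (divr_ge0 u0 (ltW e0)); have := truncn_itv (divr_ge0 v0 (ltW e0)).
rewrite E ler_pdivlMr// ltr_pdivrMr// ler_pdivlMr// ltr_pdivrMr// -natr1 mulrDl mul1r.
by move=> /andP[? ?] /andP[? ?]; rewrite ler_distl; apply/andP; split; lra.
Qed.

Section ShellCover.
Context {R : realType} {m : nat}.
Implicit Types (x y z : 'rV[R]_m.+1) (r h eta : R).

Definition top_coord (d : 'rV[R]_m.+1) : 'I_m.+1 :=
  [arg max_(i > ord0) `|d ord0 i|]%O.

(** The cell of u in the subdivision of [-r, r] from the left end in steps of
    eta; [shell_class] is used with N equal to the index of the last cell. *)
Definition grid_cell r eta (N : nat) (u : R) : 'I_N.+1 :=
  inord (Num.truncn ((u + r) / eta)).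

Definition shell_class x r eta N y :
    'I_m.+1 * bool * {ffun 'I_m -> 'I_N.+1} :=
  let d := y - x in let i := top_coord d in
  (i, 0 <= d ord0 i, [ffun k => grid_cell r eta N (d ord0 (lift i k))]).

Lemma top_coord_ge (d : 'rV[R]_m.+1) :
  enorm d ^+ 2 <= m.+1%:R * d ord0 (top_coord d) ^+ 2.
Proof.
rewrite sqr_enorm mulr_natl -[X in _ <= _ *+ X]card_ord -sumr_const.
apply: ler_sum => i _; rewrite /top_coord.
case: arg_maxP => // j _ /(_ i isT) ij.
by rewrite -real_normK ?num_real// -[leRHS]real_normK ?num_real// lerXn2r// nnegrE.
Qed.

Lemma coord_le_enorm (d : 'rV[R]_m.+1) r i :
  0 <= r -> enorm d ^+ 2 <= r ^+ 2 -> `|d ord0 i| <= r.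
Proof.
move=> r0; rewrite sqr_enorm (bigD1 i)//= => dr.
rewrite -(@ler_pXn2r _ 2)// ?nnegrE// real_normK ?num_real//.
by apply: le_trans dr; rewrite lerDl sumr_ge0// => j _; rewrite sqr_ge0.
Qed.

Lemma grid_cell_dist r eta u v : 0 < eta -> `|u| <= r -> `|v| <= r ->
  grid_cell r eta (Num.truncn (r *+ 2 / eta)) u =
  grid_cell r eta (Num.truncn (r *+ 2 / eta)) v -> `|u - v| <= eta.
Proof.
move=> e0 ur vr /(congr1 val).
have lt w : `|w| <= r ->
    (Num.truncn ((w + r) / eta) < (Num.truncn (r *+ 2 / eta)).+1)%N.
  move=> /(le_trans (ler_norm _)) wr; rewrite ltnS; apply: le_truncn.
  by rewrite ler_pM2r ?invr_gt0// mulr2n lerD2r.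
have ge0 w : `|w| <= r -> 0 <= w + r.
  by rewrite ler_norml => /andP[? _]; rewrite -lerBlDr sub0r.
rewrite /grid_cell /= !inordK ?lt// => /same_cell_dist.
by rewrite opprD addrACA subrr addr0; apply; rewrite ?ge0.
Qed.

(** In dimension n = m + 1 the top coordinate a satisfies |a| >= r / (2 n) and
    its square varies by at most h^2 + 2 n eta r = (2 n + 1) eta r on a class.
    Two such coordinates of the same sign then have a sum of absolute value at
    least r / n, whence the width n (2 n + 1) eta. *)
Definition class_width eta N (t : 'I_m.+1 * bool * {ffun 'I_m -> 'I_N.+1})
    (j : 'I_m.+1) : R :=
  if j == t.1.1 then m.+1%:R * (m.+1%:R *+ 2 + 1) * eta else eta.

Lemma shell_class_dist x r h y z : 0 < r -> 0 < h < r / 2 ->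
  shell x r h y -> shell x r h z ->
  let eta := h ^+ 2 / r in
  let cl := shell_class x r eta (Num.truncn (r *+ 2 / eta)) in
  cl y = cl z -> forall j, `|y ord0 j - z ord0 j| <= class_width eta (cl y) j.
Proof.
move=> r0 /andP[h0 hr] /andP[y1 y2] /andP[z1 z2] eta cl.
set i := top_coord (y - x).
have e0 : 0 < eta by rewrite divr_gt0// exprn_gt0.
have er : eta * r = h ^+ 2 by rewrite divfK// gt_eqF.
have yb j := coord_le_enorm j (ltW r0) y2.
have zb j := coord_le_enorm j (ltW r0) z2.
have yi := top_coord_ge (y - x); have zi := top_coord_ge (z - x).
move=> [E1]; rewrite -E1 -/i in zi *; rewrite -/i in yi; move=> E2 /ffunP E3.
have dE j : y ord0 j - z ord0 j = (y - x) ord0 j - (z - x) ord0 j.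
  by rewrite !mxE; ring.
have other j : j != i -> `|(y - x) ord0 j - (z - x) ord0 j| <= eta.
  rewrite eq_sym => /unlift_some[k -> _].
  by have := E3 k; rewrite !ffunE; exact: grid_cell_dist.
move=> j; rewrite /class_width /= -/i dE; have [->|/other//] := eqVneq.
set u := (y - x) ord0 i in yi E2 *; set v := (z - x) ord0 i in zi E2 *.
have m1 : 1 <= m.+1%:R :> R by rewrite ler1n.
(* h < r / 2 gives r^2 - h^2 >= 3 r^2 / 4 >= r^2 / 4. *)
have big w : r ^+ 2 - h ^+ 2 <= m.+1%:R * w ^+ 2 -> r <= m.+1%:R * `|w| *+ 2.
  move=> hw; rewrite -(@ler_pXn2r _ 2)// ?nnegrE; [|exact: ltW|by rewrite mulrn_wge0// mulr_ge0].
  have : h ^+ 2 <= (r / 2) ^+ 2 by rewrite lerXn2r// ?nnegrE ltW// divr_gt0.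
  have -> : (m.+1%:R * `|w| *+ 2) ^+ 2 = m.+1%:R * (m.+1%:R * w ^+ 2) *+ 4.
    by rewrite -[w ^+ 2]real_normK ?num_real//; ring.
  have : m.+1%:R * w ^+ 2 <= m.+1%:R * (m.+1%:R * w ^+ 2).
    by rewrite ler_peMl// mulr_ge0// sqr_ge0.
  move: (m.+1%:R * (m.+1%:R * w ^+ 2)) hw => q; move: (m.+1%:R * w ^+ 2) => q'.
  have -> : (r / 2) ^+ 2 = r ^+ 2 / 4 by field.
  have := sqr_ge0 r; lra.
have ub := big u (le_trans y1 yi); have vb := big v (le_trans z1 zi).
(* The squared norms differ by at most h^2 in the shell, and each of the other
   squares by at most eta (2 r). *)
have sum_diff : `|u ^+ 2 - v ^+ 2| <= h ^+ 2 + m.+1%:R * (eta * (r *+ 2)).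
  have -> : u ^+ 2 - v ^+ 2 = (enorm (y - x) ^+ 2 - enorm (z - x) ^+ 2)
     - \sum_(j | j != i) ((y - x) ord0 j ^+ 2 - (z - x) ord0 j ^+ 2).
    by rewrite !sqr_enorm !(bigD1 i isT)/= sumrB -/u -/v; ring.
  rewrite (le_trans (ler_normB _ _))// lerD//.
    by rewrite ler_norml; apply/andP; split; lra.
  apply: le_trans (ler_norm_sum _ _ _) _.
  apply: (@le_trans _ _ (\sum_(j | j != i) eta * (r *+ 2))).
    apply: ler_sum => k ki; rewrite subr_sqr normrM ler_pM ?other//.
    by rewrite (le_trans (ler_normD _ _))// mulr2n lerD.
  have -> : m.+1%:R * (eta * (r *+ 2)) = \sum_(j < m.+1) eta * (r *+ 2).
    by rewrite sumr_const card_ord mulr_natl.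
  rewrite [leRHS](bigID (fun j => j != i))/=.
  by rewrite lerDl sumr_ge0// => k _; rewrite mulr_ge0 ?mulrn_wge0 // ltW.
(* The class fixes the sign, which rules out cancellation in u + v. *)
have nuv : `|u + v| = `|u| + `|v|.
  have [u0|u0] := lerP 0 u.
    have v0 : 0 <= v by rewrite -E2 u0.
    by rewrite !ger0_norm ?addr_ge0.
  have v0 : v < 0 by rewrite ltNge -E2 -ltNge.
  by rewrite !ltr0_norm ?opprD// -oppr_gt0 opprD addr_gt0// oppr_gt0.
have uvr : r <= m.+1%:R * `|u + v| by rewrite nuv mulrDr; lra.
rewrite -(ler_pM2r r0).
have -> : m.+1%:R * (m.+1%:R *+ 2 + 1) * eta * r =
    m.+1%:R * (h ^+ 2 + m.+1%:R * (eta * (r *+ 2))).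
  by rewrite -er; ring.
rewrite (le_trans (ler_wpM2l (normr_ge0 (u - v)) uvr))// mulrCA ler_wpM2l//.
by rewrite -normrM -subr_sqr.
Qed.

End ShellCover.

(** The product of 2 n K^m classes, K being the number of cells in one
    direction, by the volume 2 n (2 n + 1) eta (2 eta)^m of a box, bounded using
    K eta <= 3 r; here n = m + 1 and eta = h^2 / r. *)
Definition shell_constant (R : realType) (m : nat) : R :=
  m.+1%:R ^+ 2 * (m.+1%:R *+ 2 + 1) * 6 ^+ m *+ 4.

Lemma lebesgue_measure_n_shell_le (R : realType) m (x : 'rV[R]_m.+1) r h A :
  0 < r -> 0 < h < r / 2 -> A `<=` shell x r h ->
  (lebesgue_measure_n A <=
     (shell_constant R m * h ^+ 2 * r ^ (m.+1%:Z - 2))%:E)%E.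
Proof.
move=> r0 hr Ash.
pose eta := h ^+ 2 / r.
have [h0 hr2] := andP hr.
have e0 : 0 < eta by rewrite divr_gt0// exprn_gt0.
have er : eta <= r.
  rewrite ler_pdivrMr// -expr2 lerXn2r// ?nnegrE; lra.
pose N := Num.truncn (r *+ 2 / eta).
pose L : R := m.+1%:R * (m.+1%:R *+ 2 + 1) * eta.
have L0 : 0 <= L by rewrite mulr_ge0 ?(ltW e0)// mulr_ge0// addr_ge0// mulrn_wge0.
apply: le_trans (@lebesgue_measure_n_le_classes _ _ _ A (shell_class x r eta N)
  (@class_width _ _ eta N) (L *+ 2 * (eta *+ 2) ^+ m) _ _ _) _.
- by move=> t j; rewrite /class_width; case: ifP => // _; exact: ltW.
- by move=> y z /Ash Ay /Ash Az; exact: shell_class_dist.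
- move=> t; rewrite (bigD1 t.1.1)//= /class_width eqxx ler_wpM2l ?mulrn_wge0//.
  rewrite (eq_bigr (fun=> eta *+ 2)) => [|j /negPf->//].
  by rewrite prodr_const cardC1 card_ord.
rewrite lee_fin !card_prod card_bool card_ffun !card_ord.
have -> : r ^ (m.+1%:Z - 2) = r ^+ m / r.
  have -> : m.+1%:Z - 2 = m%:Z - 1 by lia.
  by rewrite expfzDr ?gt_eqF// exprN1.
have grid : (N.+1%:R * (eta *+ 2)) ^+ m <= (6 * r) ^+ m :> R.
  rewrite lerXn2r// ?nnegrE ?mulr_ge0 ?mulrn_wge0 ?(ltW e0) ?(ltW r0)//.
  have : N%:R * eta <= r *+ 2.
    rewrite -ler_pdivlMr//.
    by have /andP[] := truncn_itv (divr_ge0 (mulrn_wge0 2 (ltW r0)) (ltW e0)).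
  rewrite -natr1; lra.
have -> : (m.+1 * 2 * N.+1 ^ m)%:R * (L *+ 2 * (eta *+ 2) ^+ m) =
    m.+1%:R * L *+ 4 * (N.+1%:R * (eta *+ 2)) ^+ m :> R.
  by rewrite !natrM natrX exprMn; ring.
apply: (@le_trans _ _ (m.+1%:R * L *+ 4 * (6 * r) ^+ m)).
  by rewrite ler_wpM2l// mulrn_wge0// mulr_ge0.
rewrite le_eqVlt; apply/orP; left; apply/eqP.
rewrite /shell_constant /L /eta exprMn; field; lra.
Qed.

Theorem theorem3p4 (R : realType) (n : nat) (n_ge1 : (1 <= n)%N) :
  exists2 C : R, 0 < C &
    forall (Omega : set 'rV[R]_n) (delta h : R)
           (B : 'rV[R]_n -> set 'rV[R]_n),
      bounded_set Omega -> open Omega ->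
      0 < delta -> 0 < h < delta / 2 ->
      let Omegahat := Omega `|` interaction_domain Omega delta in
      let DB x := Omegahat `&` (eball x delta `+` B x) in
      let DB' x := Omega `&` (eball x delta `+` dual_ball Omega B x) in
      (forall x, Omega x -> inscribed_polyhedral_approx x delta (B x)) ->
      (forall x, Omega x ->
         exists2 F, simplicial_faces (B x) F & edges_shorter_than F h) ->
      (forall x, Omega x -> lebesgue_measurable (DB x)) ->
      (forall x, Omegahat x -> lebesgue_measurable (DB' x)) ->
      (ereal_sup [set lebesgue_measure_n (DB x) | x in Omega] +
       ereal_sup [set lebesgue_measure_n (DB' x) | x in Omegahat]
         <= (C * h ^+ 2 * delta ^ (n%:Z - 2))%:E)%E.
Proof.
case: n n_ge1 => // m _.
(* Each of the two suprema is at most the bound for the shell. *)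
exists (shell_constant R m *+ 2).
  by rewrite pmulrn_lgt0// pmulrn_lgt0// !mulr_gt0 ?exprn_gt0 ?addr_gt0 ?mulrn_wgt0.
move=> Omega delta h B _ _ delta_gt0 hdelta Omegahat DB DB' Bapprox Bfaces _ _.
have h_ge0 : 0 <= h by case/andP: hdelta => /ltW.
have Bshell x : Omega x -> eball x delta `+` B x `<=` shell x delta h.
  move=> Ox; apply: ball_symdiff_sub_shell (Bapprox x Ox) _ => //.
  have [_ _ Bsphere] := Bapprox x Ox.
  have [F [[_ _ ->] Fvert] Fshort] := Bfaces x Ox.
  move=> p [v Fv vp]; apply: simplex_in_shell vp => //; last first.
    by move=> i j ij; apply/ltW/Fshort.
  by apply: subset_trans Bsphere; rewrite -Fvert => q vq; exists v.
have DBle x : Omega x -> (lebesgue_measure_n (DB x) <=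
    (shell_constant R m * h ^+ 2 * delta ^ (m.+1%:Z - 2))%:E)%E.
  move=> Ox; apply: (@lebesgue_measure_n_shell_le _ _ x) => //.
  by move=> y [_ /(Bshell _ Ox)].
have DB'le x : (lebesgue_measure_n (DB' x) <=
    (shell_constant R m * h ^+ 2 * delta ^ (m.+1%:Z - 2))%:E)%E.
  apply: (@lebesgue_measure_n_shell_le _ _ x) => // y [Oy xy].
  apply/shell_sym/(Bshell _ Oy).
  have bC : eball x delta y <-> eball y delta x by rewrite /eball/= enorm_distC.
  by case: xy => [[/bC yx nB]|[[_ By] /bC yx]]; [left|right]; split=> // Byx; apply: nB.
rewrite mulrnAl mulrnAl mulr2n EFinD leeD// ge_ereal_sup// => _ [x Ox <-] //.
exact: DBle.
Qed.
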